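(* Let $M=(M_n)_{n\ge 0}$ be the Thue--Morse sequence. Let $\theta=(\theta_n)_{n\ge 0}$ be the sequence over $\{0,1,2\}$ obtained from $M$ by replacing the second digit of each occurrence of $00$ and of $11$ in $M$ by $2$; that is, $\theta_0=M_0=0$ and, for $n\ge 1$, $\theta_n=2$ if $M_n=M_{n-1}$ and $\theta_n=M_n$ otherwise. Let $\vartheta=(\vartheta_n)_{n\ge 0}$ be the sequence over $\{0,1,2\}$ obtained from $M$ by replacing the first digit of each occurrence of $00$ and of $11$ in $M$ by $2$; that is, for $n\ge 0$, $\vartheta_n=2$ if $M_n=M_{n+1}$ and $\vartheta_n=M_n$ otherwise. Then both $\theta$ and $\vartheta$ are square-free.
   Context: The Thue--Morse sequence $M=(M_n)_{n\ge 0}=0110100110010110\cdots$ is the limit of the words $M^{2^n}$ of length $2^n$ defined by: the initial word (length $1$) is $0$, and $M^{2^{n+1}}=M^{2^n}\,\overline{M^{2^n}}$, where $\overline{W}$ is the word obtained from $W$ by switching $0$ and $1$. Equivalently, $M_0=0$, $M_{2n}=M_n$, $M_{2n+1}=1-M_n$. A block (word) in a sequence is a finite nonempty word formed by consecutive terms. A sequence is square-free if no word of the form $BB$, with $B$ a nonempty word, appears in it as a block of consecutive terms. *)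

(* Defs.v *)
From mathcomp Require Import all_boot.

Set Implicit Arguments.
Unset Strict Implicit.
Unset Printing Implicit Defensive.

Definition occurs (T : Type) (w : seq T) (u : nat -> T) : Prop :=
  exists i : nat, w = mkseq (fun k => u (i + k)) (size w).

Definition square_free (T : Type) (u : nat -> T) : Prop :=
  forall B : seq T, B <> [::] -> ~ occurs (B ++ B) u.

(* Binary digits are booleans: false is 0, true is 1. [tm_word n] is the word
   of length [2 ^ n]. *)
Fixpoint tm_word (n : nat) : seq bool :=
  if n is m.+1 then tm_word m ++ map negb (tm_word m) else [:: false].

(* The limit of the words [tm_word k]: as [n < 2 ^ n], the word [tm_word n] is
   long enough to have a letter at position [n], and by [thue_morse_limit]
   all longer words have the same one there. *)
Definition thue_morse (n : nat) : bool := nth false (tm_word n) n.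

Lemma size_tm_word n : size (tm_word n) = 2 ^ n.
Proof. by elim: n => //= n IHn; rewrite size_cat size_map IHn expnS mul2n addnn. Qed.

Lemma nth_tm_wordD n d i :
  i < 2 ^ n -> nth false (tm_word (n + d)) i = nth false (tm_word n) i.
Proof.
move=> lt_i; elim: d => [|d IHd]; first by rewrite addn0.
rewrite addnS /= nth_cat size_tm_word (leq_trans lt_i) //.
by rewrite leq_exp2l // leq_addr.
Qed.

Lemma thue_morse_limit n i :
  i < 2 ^ n -> thue_morse i = nth false (tm_word n) i.
Proof.
move=> lt_i; rewrite /thue_morse.
have [le_in | /ltnW le_ni] := leqP i n.
  by rewrite -(subnKC le_in) nth_tm_wordD // ltn_expl.
by rewrite -(subnKC le_ni) nth_tm_wordD // subnKC.
Qed.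

Definition digit (b : bool) : 'I_3 := inord b.

Definition two : 'I_3 := ord_max.

Definition theta (n : nat) : 'I_3 :=
  if n is m.+1 then
    if thue_morse m.+1 == thue_morse m then two else digit (thue_morse m.+1)
  else digit (thue_morse 0).

Definition vartheta (n : nat) : 'I_3 :=
  if thue_morse n == thue_morse n.+1 then two else digit (thue_morse n).

(* Main.v *)
Require Import Defs.
From mathcomp Require Import all_boot.

Set Implicit Arguments.
Unset Strict Implicit.
Unset Printing Implicit Defensive.

(** Write [M] for the Thue-Morse sequence. Both sequences record, for each pair
    of neighbouring letters of [M], either that they agree (letter 2) or the
    value of one of them; so [theta n.+1] is [vartheta n] with the letters 0
    and 1 exchanged.

    A square of period [p] in [vartheta] says that the increments of [M] repeat
    with period [p], hence that [M] at [k] and at [k + p] are always equal or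
    always opposite along the square. The second case would make every letter
    of the square a 2, so that [M] would be constant there, which is absurd.
    Hence [M] itself repeats over [p.+1] consecutive places: it has an overlap
    ([overlap_of_vartheta_square]). But [M] has none ([thue_morse_overlap_free]):
    an even period can be halved using [M (2 n) = M n] and [M (2 n + 1) = ~~ M n],
    and an odd period [p] forces [M] to alternate, so that its values at [i] and
    at [i + p] are opposite, whereas the overlap makes them equal.

    A square in [theta] not starting at 0 is a square in [vartheta] one place to
    the left. At 0 there is no place to the left, and one obtains only a square
    of [M] rather than an overlap; the same halving argument shows that no
    prefix of [M] is a square ([thue_morse_no_prefix_square]). *)

(** * Squares as periodic windows *)

Definition square_at (T : Type) (u : nat -> T) (i p : nat) : Prop :=
  forall k, k < p -> u (i + k) = u (i + p + k).

Lemma square_free_of_no_square_at (T : Type) (u : nat -> T) :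
  (forall i p, 0 < p -> ~ square_at u i p) -> square_free u.
Proof.
move=> no_sq B B_neq0 [i eqBB]; apply: (no_sq i (size B)) => [|k lt_k].
  by case: B B_neq0 {eqBB}.
have nthBB j : j < size (B ++ B) -> nth (u 0) (B ++ B) j = u (i + j).
  by move=> lt_j; rewrite eqBB nth_mkseq.
rewrite -addnA -!nthBB ?size_cat ?ltn_add2l ?ltn_addr //.
by rewrite !nth_cat lt_k ltnNge leq_addr addKn.
Qed.

(** * Overlaps in the Thue-Morse sequence *)

(** The words double by appending their complement, whereas the recurrence
    refines each letter in place; the two descriptions agree because the
    refinement commutes with complementation. *)
Lemma nth_tm_word_double n i (b : bool) : i < 2 ^ n ->
  nth false (tm_word n.+1) (b + i.*2) = b (+) nth false (tm_word n) i.
Proof.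
elim: n i => [|n IHn] i lt_i.
  by move: lt_i; rewrite expn0 ltnS leqn0 => /eqP ->; case: b.
have double_lt m j : (b + j.*2 < 2 ^ m.+1) = (j < 2 ^ m).
  by rewrite expnS mul2n; case: (b); rewrite ?add1n ?add0n ?ltn_double ?ltn_Sdouble.
have nth_tm_wordS m j : nth false (tm_word m.+1) j =
    if j < 2 ^ m then nth false (tm_word m) j
    else nth false (map negb (tm_word m)) (j - 2 ^ m).
  by rewrite -size_tm_word -nth_cat.
rewrite nth_tm_wordS (nth_tm_wordS n i) double_lt.
case: ltnP => [/IHn // | le_i].
have lt_i' : i - 2 ^ n < 2 ^ n by rewrite ltn_subLR // addnn -mul2n -expnS.
have -> : b + i.*2 - 2 ^ n.+1 = b + (i - 2 ^ n).*2.
  by rewrite expnS mul2n -addnBA ?leq_double // -doubleB.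
by rewrite !(nth_map false) ?size_tm_word ?double_lt // IHn // addbN.
Qed.

Lemma thue_morse_double (b : bool) n : thue_morse (b + n.*2) = b (+) thue_morse n.
Proof.
have lt_n : n < 2 ^ n by apply: ltn_expl.
rewrite (thue_morse_limit lt_n) -(nth_tm_word_double b lt_n).
apply: thue_morse_limit; rewrite expnS mul2n.
by case: b; rewrite ?add1n ?add0n ?ltn_double ?ltn_Sdouble.
Qed.

Lemma thue_morse1_2 : thue_morse 1 = thue_morse 2.
Proof. by []. Qed.

(* Unfolding would make conversion compute with words of exponential length. *)
#[local] Opaque thue_morse.

Lemma thue_morse_even n : thue_morse n.*2 = thue_morse n.
Proof. exact: (thue_morse_double false). Qed.

Lemma thue_morse_add_double i k :
  thue_morse (i + k.*2) = odd i (+) thue_morse (i./2 + k).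
Proof.
by rewrite -{1}(odd_double_half i) -addnA -doubleD thue_morse_double.
Qed.

Lemma thue_morse_even_succ n : ~~ odd n -> thue_morse n.+1 = ~~ thue_morse n.
Proof.
move=> /even_halfK <-.
by rewrite (thue_morse_double true) thue_morse_even.
Qed.

(** Of the places [n] and [m], one is even, and there [M] changes; since the
    increments at the two places are the same, it changes at both. *)
Lemma thue_morse_step_odd_shift n m : odd n != odd m ->
  thue_morse n = thue_morse m -> thue_morse n.+1 = thue_morse m.+1 ->
  thue_morse n.+1 = ~~ thue_morse n.
Proof.
move=> neq_odd eq_nm eq_nm1; case odd_n: (odd n) neq_odd => neq_odd.
  by rewrite eq_nm1 eq_nm thue_morse_even_succ //; case: (odd m) neq_odd.
by rewrite thue_morse_even_succ ?odd_n.
Qed.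

Definition overlap_at (T : Type) (u : nat -> T) (i p : nat) : Prop :=
  forall k, k <= p -> u (i + k) = u (i + p + k).

(** Halving keeps an overlap an overlap, whatever the parity of [i]: the places
    [i + 2 k] all have the parity of [i], so [M] there is [M] at the half place,
    complemented at all of them or at none. *)
Lemma thue_morse_overlap_free i p : 0 < p -> ~ overlap_at thue_morse i p.
Proof.
elim/ltn_ind: p i => p IHp i p_gt0 ovl; case odd_p: (odd p).
  have alternates k : k < p -> thue_morse (i + k.+1) = ~~ thue_morse (i + k).
    move=> lt_k; rewrite !addnS (@thue_morse_step_odd_shift _ (i + p + k)) //.
    - by rewrite !oddD odd_p; case: (odd i); case: (odd k).
    - exact/ovl/ltnW.
    - by rewrite -!addnS; apply: ovl.
  have parity k : k <= p -> thue_morse (i + k) = odd k (+) thue_morse i.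
    elim: k => [|k IHk] lt_k; first by rewrite addn0.
    by rewrite (alternates k lt_k) (IHk (ltnW lt_k)) addNb.
  have := ovl 0 isT; rewrite !addn0 parity // odd_p.
  by case: (thue_morse i).
have Dp : p./2.*2 = p by rewrite even_halfK ?odd_p.
have half_gt0 : 0 < p./2 by rewrite -double_gt0 Dp.
apply: (IHp p./2 _ i./2 half_gt0) => [|k le_k].
  by rewrite -{2}Dp -addnn -{1}[p./2]addn0 ltn_add2l.
have /ovl: k.*2 <= p by rewrite -Dp leq_double.
have -> : i + p + k.*2 = i + (p./2 + k).*2 by rewrite doubleD Dp addnA.
rewrite !thue_morse_add_double addnA.
exact: addbI.
Qed.

(** Without the extra letter of an overlap, the equality of [M 0] and [M p]
    does not contradict alternation inside each copy. For odd [p >= 3]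
    the start of [M] supplies the contradiction: [M] changes at the even place
    [p + 1], hence also at place 1, while [M 1 = M 2]. *)
Lemma thue_morse_no_prefix_square p : 0 < p -> ~ square_at thue_morse 0 p.
Proof.
elim/ltn_ind: p => p IHp p_gt0 sq; case odd_p: (odd p).
  have [p_le2 | p_gt2] := leqP p 2.
    by move: p_gt0 p_le2 odd_p sq; case: p {IHp} => [|[|[|p]]] // _ _ _ /(_ 0 isT).
  have sq1 : thue_morse 1 = thue_morse p.+1 by rewrite (sq 1 (ltnW p_gt2)) addn1.
  have sq2 : thue_morse 2 = thue_morse p.+2 by rewrite (sq 2 p_gt2) addn2.
  have neq_odd : odd 1 != odd p.+1 by rewrite /= odd_p.
  move: (thue_morse_step_odd_shift neq_odd sq1 sq2); rewrite -thue_morse1_2.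
  by case: (thue_morse 1).
have Dp : p./2.*2 = p by rewrite even_halfK ?odd_p.
have half_gt0 : 0 < p./2 by rewrite -double_gt0 Dp.
apply: (IHp p./2 _ half_gt0) => [|k lt_k].
  by rewrite -{2}Dp -addnn -{1}[p./2]addn0 ltn_add2l.
have /sq: k.*2 < p by rewrite -Dp ltn_double.
by rewrite -{1}Dp !add0n -doubleD !thue_morse_even.
Qed.

(** * The ternary sequences *)

Lemma val_digit b : val (digit b) = b.
Proof. by rewrite /= inordK //; case: b. Qed.

Lemma digit_inj : injective digit.
Proof. by move=> b c /(congr1 val); rewrite !val_digit; case: b; case: c. Qed.

Lemma digit_neq_two b : digit b != two.
Proof. by rewrite -val_eqE val_digit; case: b. Qed.

(** A letter other than 2 gives both neighbouring letters of [M], a letter 2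
    gives them up to a common complement. *)
Lemma vartheta_eq n m : vartheta n = vartheta m <->
  (thue_morse n == thue_morse n.+1) = (thue_morse m == thue_morse m.+1) /\
  (thue_morse n != thue_morse n.+1 -> thue_morse n = thue_morse m).
Proof.
rewrite /vartheta; case: eqP => _; case: eqP => _; split=> //.
- by move=> eq2; case/eqP: (digit_neq_two (thue_morse m)).
- by case.
- by move=> eq2; case/eqP: (digit_neq_two (thue_morse n)).
- by case.
- by move/digit_inj.
- by case=> _ ->.
Qed.

Lemma theta_succ n : theta n.+1 =
  if thue_morse n == thue_morse n.+1 then two else digit (thue_morse n.+1).
Proof. by rewrite eq_sym. Qed.

(** Both letters describe the pair at [n] and [n.+1]; when its members differ,
    naming either one names the other. *)
Lemma theta_succ_eq n m : theta n.+1 = theta m.+1 -> vartheta n = vartheta m.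
Proof.
move=> eq_theta; apply/vartheta_eq; move: eq_theta; rewrite !theta_succ.
have neq_two := digit_neq_two.
case: (thue_morse n =P _) => neq_n; case: (thue_morse m =P _) => neq_m //= eq2.
- by case/eqP: (neq_two (thue_morse m.+1)).
- by case/eqP: (neq_two (thue_morse n.+1)).
- split=> // _; move/digit_inj: eq2 neq_n neq_m => ->.
  by do 3!case: (thue_morse _).
Qed.

Lemma overlap_of_vartheta_square i p :
  square_at vartheta i p -> overlap_at thue_morse i p.
Proof.
move=> sq.
have step k : k < p ->
    (thue_morse (i + k) == thue_morse (i + k.+1)) =
      (thue_morse (i + p + k) == thue_morse (i + p + k.+1)) /\
    (thue_morse (i + k) != thue_morse (i + k.+1) ->
      thue_morse (i + k) = thue_morse (i + p + k)).
  by move=> /sq/vartheta_eq; rewrite -!addnS.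
have agree k : k <= p ->
    (thue_morse (i + k) == thue_morse (i + p + k)) =
    (thue_morse i == thue_morse (i + p)).
  elim: k => [|k IHk] lt_k; first by rewrite !addn0.
  rewrite -(IHk (ltnW lt_k)); have [+ _] := step k lt_k.
  by do 4!case: (thue_morse _).
suff eq_ip : thue_morse i = thue_morse (i + p).
  by move=> k /agree; rewrite eq_ip eqxx => /eqP.
apply/eqP/negPn/negP => neq_ip.
(* Opposite windows leave only the letter 2, so [M] is constant up to [i + p]. *)
have const k : k <= p -> thue_morse (i + k) = thue_morse i.
  elim: k => [|k IHk] lt_k; first by rewrite addn0.
  rewrite -(IHk (ltnW lt_k)); have [_] := step k lt_k.
  have := agree k (ltnW lt_k); rewrite (negPf neq_ip).
  case: (thue_morse (i + k) =P thue_morse (i + k.+1)) => // _ /eqP neq_k eq_k.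
  by case: neq_k; apply: eq_k.
by rewrite const ?eqxx in neq_ip.
Qed.

Lemma vartheta_no_square_at i p : 0 < p -> ~ square_at vartheta i p.
Proof.
by move=> p_gt0 /overlap_of_vartheta_square; apply: thue_morse_overlap_free.
Qed.

(** The initial letter 0 of [theta], repeated at [p], fixes [M p = M 0]; equality
    then propagates along the equal increments. *)
Lemma prefix_square_of_theta_square p :
  0 < p -> square_at theta 0 p -> square_at thue_morse 0 p.
Proof.
case: p => // p _ sq; elim=> [|k IHk] lt_k.
  have := sq 0 isT; rewrite !addn0 add0n theta_succ.
  case: eqP => _; last exact: digit_inj.
  by move=> eq2; case/eqP: (digit_neq_two (thue_morse 0)).
have /theta_succ_eq/vartheta_eq[+ _] : theta k.+1 = theta (p.+1 + k).+1.
  by rewrite -addnS (sq k.+1).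
move: (IHk (ltnW lt_k)); rewrite !add0n addnS => ->.
by do 3!case: (thue_morse _).
Qed.

Lemma theta_no_square_at i p : 0 < p -> ~ square_at theta i p.
Proof.
move=> p_gt0; case: i => [|i] sq.
  exact: thue_morse_no_prefix_square (prefix_square_of_theta_square p_gt0 sq).
apply: (@vartheta_no_square_at i p) => // k lt_k.
by apply: theta_succ_eq; rewrite -!addSn sq.
Qed.

Theorem theorem3p1 : square_free theta /\ square_free vartheta.
Proof.
split; apply: square_free_of_no_square_at.
- exact: theta_no_square_at.
- exact: vartheta_no_square_at.
Qed.
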